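(* Let $m$, $k$, $n$, and $N$ be integers such that $e_w u_n u_{2km}\neq 0$ and such that all Horadam numbers occurring in denominators below are nonzero. Then $$\sum_{i = 1}^N \frac{q^{m(i - k)}}{w_{m(i - k) + n}\, w_{m(i + k) + n}} = \frac{1}{e_w u_n u_{2km}}\sum_{i = 1}^{2k} \left( \frac{w_{m(i - k)}}{w_{m(i - k) + n}}-\frac{w_{m(i + N - k)}}{w_{m(i + N - k) + n}} \right)$$ or, equivalently, $$u_{2km} \sum_{i = 1}^N \frac{q^{mi}}{w_{m(i - k) + n}\, w_{m(i + k) + n}} = u_{mN} \sum_{i = 1}^{2k} \frac{q^{mi}}{w_{m(i - k) + n}\, w_{m(i + N - k) + n}}.$$
   Context: Let $a,b,p,q$ be complex numbers with $q\neq 0$. The Horadam sequence $(w_n)_{n\in\mathbb{Z}}=(w_n(a,b;p,q))_{n\in\mathbb{Z}}$ is defined by $w_0=a$, $w_1=b$, $w_n=pw_{n-1}-qw_{n-2}$, extended by the same recurrence to all integer indices. Put $u_n=w_n(0,1;p,q)$. Let $\alpha,\beta$ be the roots of $x^2-px+q=0$; they are assumed distinct, i.e. $\Delta=p^2-4q\neq 0$, with $|\alpha|>|\beta|$. For all $n\in\mathbb{Z}$, $w_n=\frac{A\alpha^n-B\beta^n}{\alpha-\beta}$ with $A=b-a\beta$, $B=b-a\alpha$, and $u_n=\frac{\alpha^n-\beta^n}{\alpha-\beta}$. Put $e_w=-AB=pab-qa^2-b^2$. Summation convention for an integer upper limit $M\le 0$: $\sum_{i=1}^{0}g(i)=0$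 and $\sum_{i=1}^{M}g(i)=-\sum_{i=M+1}^{0}g(i)$ for $M<0$. *)

(* Defs.v *)
From HB Require Import structures.
From mathcomp Require Import all_boot all_order all_algebra.
From mathcomp Require Import reals complex ring.

Set Implicit Arguments.
Unset Strict Implicit.
Unset Printing Implicit Defensive.

Import Order.TTheory GRing.Theory Num.Theory.
Local Open Scope ring_scope.

(* The pairs below stand for (w_j, w_(j+1)). *)
Definition horadam_up (F : fieldType) (p q : F) (s : F * F) : F * F :=
  (s.2, p * s.2 - q * s.1).

(* The recurrence solved for w_(j-1), which requires q != 0. *)
Definition horadam_down (F : fieldType) (p q : F) (s : F * F) : F * F :=
  ((p * s.1 - s.2) / q, s.1).

(* Negz j is the integer - j.+1. *)
Definition horadam (F : fieldType) (a b p q : F) (n : int) : F :=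
  match n with
  | Posz j => (iter j (horadam_up p q) (a, b)).1
  | Negz j => (iter j.+1 (horadam_down p q) (a, b)).1
  end.

Lemma horadam0 (F : fieldType) (a b p q : F) : horadam a b p q 0 = a.
Proof. by []. Qed.

Lemma horadam1 (F : fieldType) (a b p q : F) : horadam a b p q 1 = b.
Proof. by []. Qed.

Lemma horadam_rec (F : fieldType) (a b p q : F) (n : int) : q != 0 ->
  horadam a b p q n =
    p * horadam a b p q (n - 1) - q * horadam a b p q (n - 2).
Proof.
move=> q0.
have downK (s : F * F) : p * s.1 - q * (horadam_down p q s).1 = s.2.
  by rewrite /= [q * _]mulrC divfK // subKr.
case: n => [[|[|j]]|j].
- rewrite sub0r [0 - 2]sub0r -[- 1]/(Negz 0) -[- 2]/(Negz 1) /horadam !iterS.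
  by rewrite downK.
- rewrite subrr -[1 - 2]/(Negz 0) /horadam !iterS.
  by rewrite (downK (a, b)).
- have -> : Posz j.+2 - 1 = Posz j.+1 by rewrite -[j.+2]addn1 PoszD addrK.
  have -> : Posz j.+2 - 2 = Posz j by rewrite -[j.+2]addn2 PoszD addrK.
  by [].
- have -> : Negz j - 1 = Negz j.+1 by rewrite !NegzE -opprD -PoszD addn1.
  have -> : Negz j - 2 = Negz j.+2 by rewrite !NegzE -opprD -PoszD addn2.
  by rewrite /horadam [iter j.+3 _ _]iterS [iter j.+2 _ _]iterS downK.
Qed.

Definition horadam_u (F : fieldType) (p q : F) (n : int) : F :=
  horadam 0 1 p q n.

Definition horadam_e (F : fieldType) (a b p q : F) : F :=
  p * a * b - q * a ^+ 2 - b ^+ 2.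

Lemma horadam_eE (F : fieldType) (a b alpha beta : F) :
  horadam_e a b (alpha + beta) (alpha * beta) =
    - ((b - a * beta) * (b - a * alpha)).
Proof. by rewrite /horadam_e; ring. Qed.

(* The sum of g i for i from 1 to M; for M = - n.+1 it is, by convention,
   minus the sum of g i for i from M + 1 = - n to 0. *)
Definition isum (V : zmodType) (M : int) (g : int -> V) : V :=
  match M with
  | Posz n => \sum_(1 <= i < n.+1) g i%:Z
  | Negz n => - \sum_(0 <= j < n.+1) g (- j%:Z)
  end.

(* The indices i at which isum M g evaluates g, for either sign of M. *)
Definition isum_index (M i : int) : bool :=
  (1 <= i <= M) || (M + 1 <= i <= 0).

(* Main.v *)
Require Import Defs.
From HB Require Import structures.
From mathcomp Require Import all_boot all_order all_algebra.
From mathcomp Require Import reals complex ring zify.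

Set Implicit Arguments.
Unset Strict Implicit.
Unset Printing Implicit Defensive.

Import Order.TTheory GRing.Theory Num.Theory.
Local Open Scope ring_scope.

(* For F i = w_(m(i-k)) / w_(m(i-k)+n), the identity
   w_s w_(t+n) - w_t w_(s+n) = e_w u_n u_(t-s) q^s makes the summand of each of
   the two sums in the equivalent form a constant multiple of a difference
   F i - F (i + K), with K = 2k for the sum up to N and K = N for the sum up to
   2k. Both statements thus reduce to
   sum_(i=1)^N (F i - F (i + 2k)) = sum_(i=1)^(2k) (F i - F (i + N)),
   valid for any F by shifting the index. *)

(** The sign convention for negative limits is what makes this recurrence hold at every integer:
    below 0, adding [g (M + 1)] cancels one term of the negated sum. *)
Lemma isumD1 (V : zmodType) (g : int -> V) (M : int) :
  isum (M + 1) g = isum M g + g (M + 1).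
Proof.
case: M => [n|[|n]].
- by rewrite -PoszD addn1 /isum [LHS]big_nat_recr.
- have -> : Negz 0 + 1 = 0 by [].
  have isum0 : isum 0 g = 0 by rewrite [LHS]big_geq.
  by rewrite isum0 /isum big_nat1 oppr0 addNr.
- have -> : Negz n.+1 + 1 = Negz n by lia.
  by rewrite /isum [in RHS]big_nat_recr //= opprD NegzE addrNK.
Qed.

Lemma isum_shift (V : zmodType) (g : int -> V) (c M : int) :
  isum M (fun i => g (i + c)) = isum (M + c) g - isum c g.
Proof.
(* This difference does not depend on [K], so its value at 0 decides it. *)
have step K : isum (K + 1) (fun i => g (i + c)) - isum (K + 1 + c) g =
    isum K (fun i => g (i + c)) - isum (K + c) g.
  by rewrite isumD1 [K + 1 + c]addrAC isumD1 opprD addrACA subrr addr0.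
suff: isum M (fun i => g (i + c)) - isum (M + c) g = - isum c g.
  by move/(canRL (subrK _)) ->; rewrite addrC.
elim/int_rect: M => [|n IHn|n IHn].
- have -> : isum 0 (fun i => g (i + c)) = 0 by rewrite [LHS]big_geq.
  by rewrite !add0r.
- by rewrite -[n.+1]addn1 PoszD step.
- by rewrite -step -[n.+1]addn1 PoszD opprD addrNK.
Qed.

Lemma eq_isum (V : zmodType) (M : int) (f g : int -> V) :
  (forall i, isum_index M i -> f i = g i) -> isum M f = isum M g.
Proof.
case: M => [n|n] efg; rewrite /isum.
  apply: eq_big_nat => i /andP[i1 iM]; apply: efg.
  by rewrite /isum_index !lez_nat i1 -ltnS iM.
congr (- _); apply: eq_big_nat => j /andP[_ jn]; apply: efg.
rewrite /isum_index oppr_le0 NegzE; lia.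
Qed.

Lemma isumB (V : zmodType) (M : int) (f g : int -> V) :
  isum M (fun i => f i - g i) = isum M f - isum M g.
Proof.
by case: M => n; rewrite /isum sumrB // opprB opprK addrC.
Qed.

Lemma isumMl (F : pzRingType) (M : int) (c : F) (g : int -> F) :
  isum M (fun i => c * g i) = c * isum M g.
Proof. by case: M => n; rewrite /isum -mulr_sumr // mulrN. Qed.

(** After shifting, both sides equal [isum M h + isum K h - isum (M + K) h], which is symmetric in
    [M] and [K]. *)
Lemma isum_swap (V : zmodType) (h : int -> V) (M K : int) :
  isum M (fun i => h i - h (i + K)) = isum K (fun i => h i - h (i + M)).
Proof. by rewrite !isumB !isum_shift [K + M]addrC !opprB addrCA. Qed.

Lemma horadam_binet (F : fieldType) (a b alpha beta : F) (n : int) :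
  alpha * beta != 0 ->
  (alpha - beta) * horadam a b (alpha + beta) (alpha * beta) n =
    (b - a * beta) * alpha ^ n - (b - a * alpha) * beta ^ n.
Proof.
move=> q0; have /norP[al0 be0] : ~~ ((alpha == 0) || (beta == 0)).
  by rewrite -mulf_eq0.
set w := horadam _ _ _ _.
pose P j := (alpha - beta) * w j =
  (b - a * beta) * alpha ^ j - (b - a * alpha) * beta ^ j.
(* The recurrence has order two, so the induction, upwards and downwards from 0, carries two
   consecutive indices. *)
suff [] : P n /\ P (n + 1) by [].
have rec j : w (j + 2) = (alpha + beta) * w (j + 1) - alpha * beta * w j.
  rewrite /w horadam_rec // addrK.
  by have -> : j + 2 - 1 = j + 1 by lia.
have expS (x : F) (j : int) : x != 0 -> x ^ (j + 1) = x * x ^ j.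
  by move=> x0; rewrite expfzDr // expr1z mulrC.
elim/int_rect: n => [|n [Pn Pn1]|n [Pn Pn1]].
- rewrite /P !add0r !expr0z !expr1z /w horadam0 horadam1; split; ring.
- have -> : n.+1%:Z = n%:Z + 1 by lia.
  split=> //; rewrite /P -addrA rec.
  by rewrite mulrBr mulrCA Pn1 [_ * (_ * w n)]mulrCA Pn addrA !expS //; ring.
- have -> : - n.+1%:Z = - n%:Z - 1 by lia.
  rewrite addrNK; split=> //.
  have := rec (- n%:Z - 1); rewrite addrNK.
  have -> : - n%:Z - 1 + 2 = - n%:Z + 1 by lia.
  (* Going down, the recurrence yields only [alpha * beta] times the wanted value; this factor is
     cancelled by [q0]. *)
  move=> e; apply: (mulfI q0).
  have -> : alpha * beta * ((alpha - beta) * w (- n%:Z - 1)) =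
    (alpha + beta) * ((alpha - beta) * w (- n%:Z)) -
    (alpha - beta) * w (- n%:Z + 1).
    by rewrite e; ring.
  rewrite Pn Pn1 !expS //.
  have ea (x : F) : x != 0 -> x ^ (- n%:Z) = x * x ^ (- n%:Z - 1).
    by move=> x0; rewrite -expS // addrNK.
  rewrite (ea _ al0) (ea _ be0); ring.
Qed.

(** Write A = b - a beta and B = b - a alpha. In the Binet form the A^2 and B^2 terms cancel, and
    the mixed terms factor as -AB q^s (alpha^n - beta^n) (alpha^d - beta^d). *)
Lemma horadam_cross (F : fieldType) (a b alpha beta : F) (n s d : int)
  (p := alpha + beta) (q := alpha * beta) (w := horadam a b p q) :
  q != 0 -> alpha != beta ->
  w s * w (s + d + n) - w (s + d) * w (s + n) =
    horadam_e a b p q * horadam_u p q n * horadam_u p q d * q ^ s.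
Proof.
move=> q0 ab; have ab0 : alpha - beta != 0 by rewrite subr_eq0.
have /norP[al0 be0] : ~~ ((alpha == 0) || (beta == 0)) by rewrite -mulf_eq0.
apply: (mulfI ab0); apply: (mulfI ab0).
transitivity (((alpha - beta) * w s) * ((alpha - beta) * w (s + d + n)) -
   ((alpha - beta) * w (s + d)) * ((alpha - beta) * w (s + n))); first by ring.
transitivity (horadam_e a b p q * ((alpha - beta) * horadam_u p q n) *
   ((alpha - beta) * horadam_u p q d) * q ^ s); last by ring.
rewrite /w /horadam_u !horadam_binet // horadam_eE expfzMl !expfzDr //; ring.
Qed.

Lemma horadam_sub_ratio (F : fieldType) (a b alpha beta : F) (n s t : int)
  (p := alpha + beta) (q := alpha * beta) (w := horadam a b p q) :
  q != 0 -> alpha != beta -> w (s + n) != 0 -> w (t + n) != 0 ->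
  w s / w (s + n) - w t / w (t + n) =
    horadam_e a b p q * horadam_u p q n * horadam_u p q (t - s) *
      (q ^ s / (w (s + n) * w (t + n))).
Proof.
move=> q0 ab ws wt; rewrite mulrA -(horadam_cross a b n s (t - s) q0 ab).
have -> : s + (t - s) = t by lia.
by rewrite -/p -/q -/w; field; rewrite ws wt.
Qed.

Theorem theorem1 (R : realType) (a b p q alpha beta : R[i]) (m k n N : int)
  (w := horadam a b p q) (u := horadam_u p q) (ew := horadam_e a b p q)
  (hq : q != 0)
  (hroots : 'X^2 - p *: 'X + q%:P = ('X - alpha%:P) * ('X - beta%:P))
  (hDelta : p ^+ 2 - 4 * q != 0)
  (habs : `|beta| < `|alpha|)
  (hne : ew * u n * u (2 * k * m) != 0)
  (hN : forall i : int, isum_index N i ->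
     w (m * (i - k) + n) != 0 /\ w (m * (i + k) + n) != 0)
  (hk : forall i : int, isum_index (2 * k) i ->
     w (m * (i - k) + n) != 0 /\ w (m * (i + N - k) + n) != 0) :
  isum N (fun i => q ^ (m * (i - k)) /
                   (w (m * (i - k) + n) * w (m * (i + k) + n))) =
    1 / (ew * u n * u (2 * k * m)) *
    isum (2 * k) (fun i =>
      w (m * (i - k)) / w (m * (i - k) + n) -
      w (m * (i + N - k)) / w (m * (i + N - k) + n))
  /\
  u (2 * k * m) *
    isum N (fun i => q ^ (m * i) /
                     (w (m * (i - k) + n) * w (m * (i + k) + n))) =
  u (m * N) *
    isum (2 * k) (fun i => q ^ (m * i) /
                     (w (m * (i - k) + n) * w (m * (i + N - k) + n))).
Proof.
have [ep eq] : p = alpha + beta /\ q = alpha * beta.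
  (* Vieta's formulas, by evaluating the factorization at 0 and at 1. *)
  have /(congr1 (horner^~ 0)) := hroots.
  have /(congr1 (horner^~ 1)) := hroots.
  rewrite !hornerE => h1 h0.
  have {}h0 : q = alpha * beta.
    have -> : q = 0 ^+ 2 - 0 + q by ring.
    by rewrite h0; ring.
  split=> //.
  have -> : p = 1 + q - (1 ^+ 2 - p + q) by ring.
  by rewrite h1 h0; ring.
have ab : alpha != beta by apply: contraTneq habs => ->; rewrite ltxx.
(* The second form carries [q ^ (m * i)], so both its sides contain the constant factor
   [q ^ (m * k)], which is dropped at the end. *)
have qX i : q ^ (m * i) = q ^ (m * k) * q ^ (m * (i - k)).
  by rewrite -expfzDr // -mulrDr [k + _]addrC subrK.
set S1 := isum N _; set S2 := isum N _; set S3 := isum (2 * k) _.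
set S4 := isum (2 * k) _.
pose F i := w (m * (i - k)) / w (m * (i - k) + n).
have E1 : isum N (fun i => F i - F (i + 2 * k)) =
    ew * u n * u (2 * k * m) * S1.
  rewrite -isumMl; apply: eq_isum => i /hN[w1 w2].
  have e : i + 2 * k - k = i + k by lia.
  rewrite /F e /w /u /ew ep eq horadam_sub_ratio -?ep -?eq //.
  by have -> : m * (i + k) - m * (i - k) = 2 * k * m by lia.
(* The summand of [S3] is [F i - F (i + N)] by conversion. *)
have E3 : S3 = isum N (fun i => F i - F (i + 2 * k)).
  by rewrite isum_swap.
have E4 : S3 = ew * u n * u (m * N) *
    isum (2 * k) (fun i => q ^ (m * (i - k)) /
                     (w (m * (i - k) + n) * w (m * (i + N - k) + n))).
  rewrite -isumMl; apply: eq_isum => i /hk[w1 w2].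
  rewrite /w /u /ew ep eq horadam_sub_ratio -?ep -?eq //.
  by have -> : m * (i + N - k) - m * (i - k) = m * N by lia.
split; first by rewrite E3 E1 mul1r mulKf.
have -> : S2 = q ^ (m * k) * S1.
  by rewrite -isumMl; apply: eq_isum => i _; rewrite qX mulrA.
have -> : S4 = q ^ (m * k) * isum (2 * k) (fun i => q ^ (m * (i - k)) /
                     (w (m * (i - k) + n) * w (m * (i + N - k) + n))).
  by rewrite -isumMl; apply: eq_isum => i _; rewrite qX mulrA.
(* [E1] and [E4] evaluate the same quantity, by [E3]; cancelling their common factor [ew * u n]
   leaves the second form. *)
have eu0 : ew * u n != 0 by move: hne; rewrite mulf_eq0 => /norP[].
rewrite 2![_ * (q ^ _ * _)]mulrCA; congr (_ * _); apply: (mulfI eu0).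
by rewrite !mulrA -E1 -E3 E4.
Qed.
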